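(* Let $(X,\mathcal{B},\mu)$ be a probability space, let $T:X\to X$ be a (possibly noninvertible) measure-preserving transformation, and let $f\in L^1(X,\mathcal{B},\mu)$ be real-valued. For $k\ge 1$ let $A_kf=\frac1k\sum_{j=0}^{k-1} f\circ T^j$. Then the sequence $(A_kf)_{k\ge1}$ converges $\mu$-a.e., i.e. for $\mu$-almost every $x\in X$ the limit $\lim_{k\to\infty}A_kf(x)$ exists in $\mathbb{R}$.
   Context: $T$ measure-preserving means that $T$ is measurable and $\mu(T^{-1}B)=\mu(B)$ for all $B\in\mathcal{B}$. No ergodicity or invertibility of $T$ is assumed. *)

(* Defs.v *)
From HB Require Import structures.
From mathcomp Require Import all_boot all_order all_algebra.
From mathcomp Require Import all_classical all_reals all_analysis.

Set Implicit Arguments.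
Unset Strict Implicit.
Unset Printing Implicit Defensive.

Import Order.TTheory GRing.Theory Num.Theory.
Import numFieldNormedType.Exports.

Local Open Scope classical_set_scope.
Local Open Scope ring_scope.

Definition measure_preserving (d : measure_display) (X : measurableType d)
    (R : realType) (mu : {measure set X -> \bar R}) (T : X -> X) : Prop :=
  measurable_fun [set: X] T /\
  forall B : set X, measurable B -> mu (T @^-1` B) = mu B.

(* Only meaningful for 0 < k; for k = 0 the value is 0, which does not affect
   limits as k tends to infinity. *)
Definition ergodic_average (X : Type) (R : realType) (T : X -> X) (f : X -> R)
    (k : nat) (x : X) : R :=
  k%:R^-1 * \sum_(0 <= j < k) f (iter j T x).

(* Main.v *)
(* For integrable g let D(g) be the set where the Birkhoff sums S_k g are
   unbounded above.  It is invariant, and the maxima M_n of S_0 g, ..., S_n g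
   satisfy M_(n+1) = max(0, g + M_n o T).  Hence, over an invariant E included
   in D(g), M_(n+1) - M_n o T has nonnegative integral, is dominated by |g| and
   tends to g, so that the integral of g over E is nonnegative.  For a < b this
   makes the intersection of D(f - b) and D(a - f) null, and likewise the
   intersection of all D(f - n) and that of all D(- f - n).  Off these null
   sets (a and b rational) the averages converge to the infimum of the b such
   that x is not in D(f - b). *)
Require Import Defs.
From HB Require Import structures.
From mathcomp Require Import all_boot all_order all_algebra.
From mathcomp Require Import all_classical all_reals all_analysis.
From mathcomp Require Import measurable_realfun.

Set Implicit Arguments.
Unset Strict Implicit.
Unset Printing Implicit Defensive.

Import Order.TTheory GRing.Theory Num.Theory.
Import numFieldNormedType.Exports.

Local Open Scope classical_set_scope.
Local Open Scope ring_scope.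

(** * Birkhoff sums and their maxima *)

Definition birkhoff_sum (X : Type) (R : realType) (T : X -> X) (g : X -> R)
    (k : nat) (x : X) : R :=
  \sum_(0 <= j < k) g (iter j T x).

Lemma birkhoff_sum0 (X : Type) (R : realType) (T : X -> X) (g : X -> R) x :
  birkhoff_sum T g 0 x = 0.
Proof. by rewrite /birkhoff_sum big_geq. Qed.

Lemma birkhoff_sumS (X : Type) (R : realType) (T : X -> X) (g : X -> R) k x :
  birkhoff_sum T g k.+1 x = g x + birkhoff_sum T g k (T x).
Proof.
rewrite /birkhoff_sum big_nat_recl//=; congr (_ + _).
by apply: eq_bigr => j _; rewrite -iterS iterSr.
Qed.

Lemma birkhoff_sum_subr (X : Type) (R : realType) (T : X -> X) (g : X -> R)
    (b : R) k x :
  birkhoff_sum T (fun y => g y - b) k x = birkhoff_sum T g k x - b *+ k.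
Proof. by rewrite /birkhoff_sum sumrB sumr_const_nat subn0. Qed.

Definition unbounded_sums (X : Type) (R : realType) (T : X -> X) (g : X -> R) :
    set X :=
  [set x | forall M : R, exists k, M < birkhoff_sum T g k x].

Lemma unbounded_sums_invariant (X : Type) (R : realType) (T : X -> X)
    (g : X -> R) :
  T @^-1` unbounded_sums T g = unbounded_sums T g.
Proof.
apply/seteqP; split => x /= Dx M.
  have [k Mk] := Dx (M - g x).
  by exists k.+1; rewrite birkhoff_sumS -ltrBlDl.
(* The [0] in the threshold rules out the empty sum, so the length found is a successor. *)
have [[|k]] := Dx (Num.max 0 (g x + M)); rewrite gt_max => /andP[].
  by rewrite birkhoff_sum0 ltxx.
by rewrite birkhoff_sumS ltrD2l => _ Mk; exists k.
Qed.

(* The maximum of the Birkhoff sums of g of length at most n, the empty sum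
   included. *)
Fixpoint max_sum (X : Type) (R : realType) (T : X -> X) (g : X -> R) (n : nat)
    (x : X) : R :=
  if n is m.+1 then Num.max 0 (g x + max_sum T g m (T x)) else 0.

Lemma max_sum_ge0 (X : Type) (R : realType) (T : X -> X) (g : X -> R) n x :
  0 <= max_sum T g n x.
Proof. by case: n => //= n; rewrite le_max lexx. Qed.

Lemma max_sum_leS (X : Type) (R : realType) (T : X -> X) (g : X -> R) n x :
  max_sum T g n x <= max_sum T g n.+1 x.
Proof.
elim: n x => [|n IHn] x; first exact: max_sum_ge0.
by rewrite /= ge_max le_max lexx/= le_max lerD2l IHn orbT.
Qed.

Lemma birkhoff_sum_le_max_sum (X : Type) (R : realType) (T : X -> X)
    (g : X -> R) k n x :
  (k <= n)%N -> birkhoff_sum T g k x <= max_sum T g n x.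
Proof.
elim: k n x => [|k IHk] [|n] x //=; rewrite ?birkhoff_sum0 ?le_max ?lexx//.
by move=> kn; rewrite birkhoff_sumS lerD2l IHk// orbT.
Qed.

(** Stands in for the set where the upper limit of the averages exceeds [b]: it contains that set,
    and on it the upper limit is at least [b]. *)
Definition excess (X : Type) (R : realType) (T : X -> X) (f : X -> R) (b : R) :
    set X :=
  unbounded_sums T (fun y => f y - b).

(** * Convergence of the averages at a single point *)

Lemma ergodic_averageN (X : Type) (R : realType) (T : X -> X) (f : X -> R) k x :
  ergodic_average T (fun y => - f y) k x = - ergodic_average T f k x.
Proof. by rewrite /ergodic_average sumrN mulrN. Qed.

(** Some [M] bounds all the sums of [f - b] at [x], so the average is at most [b + M / k], which is
    below [c] once [k > M / (c - b)]. *)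
Lemma near_ergodic_average_lt (X : Type) (R : realType) (T : X -> X)
    (f : X -> R) (b c : R) x :
  ~ excess T f b x -> b < c ->
  \forall k \near \oo, ergodic_average T f k x < c.
Proof.
move=> /existsNP[M /forallNP DM] bc.
have cb0 : 0 < c - b by rewrite subr_gt0.
near=> k.
have k0 : 0 < k%:R :> R by rewrite ltr0n; near: k; exact: nbhs_infty_gt.
have : M / (c - b) < k%:R by near: k; exact: nbhs_infty_gtr.
rewrite ltr_pdivrMr// => Mk.
rewrite /ergodic_average ltr_pdivrMl//.
have /negP := DM k; rewrite -leNgt birkhoff_sum_subr lerBlDr => /le_lt_trans.
by apply; rewrite -[b *+ k]mulr_natl -ltrBrDr -mulrBr.
Unshelve. all: by end_near. Qed.

Lemma near_lt_ergodic_average (X : Type) (R : realType) (T : X -> X)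
    (f : X -> R) (a c : R) x :
  ~ excess T (fun y => - f y) (- a) x -> c < a ->
  \forall k \near \oo, c < ergodic_average T f k x.
Proof.
move=> Da; rewrite -ltrN2 => /(near_ergodic_average_lt Da).
by apply: filterS => k; rewrite ergodic_averageN ltrN2.
Qed.

Lemma cvg_ergodic_average (X : Type) (R : realType) (T : X -> X) (f : X -> R)
    x :
  (exists b, ~ excess T f b x) ->
  (exists a, ~ excess T (fun y => - f y) a x) ->
  (forall p q : rat, p < q ->
    ~ (excess T f (ratr q) x /\ excess T (fun y => - f y) (- ratr p) x)) ->
  cvg (ergodic_average T f k x @[k --> \oo]).
Proof.
move=> [b0 Db0] [a0 Da0] Dpq.
pose B := [set b | ~ excess T f b x].
(* The lower bound is [- a0]: if [b < - a0], the averages would eventually lie both below and above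
   the midpoint. *)
have hB : has_inf B.
  split; first by exists b0.
  exists (- a0) => b Db; rewrite leNgt; apply/negP => ba.
  have {}Da0 : ~ excess T (fun y => - f y) (- (- a0)) x by rewrite opprK.
  have /midf_lt [bm ma] := ba.
  have h1 := near_ergodic_average_lt Db bm.
  have h2 := near_lt_ergodic_average Da0 ma.
  have [k [kl kg]] := @filter_ex _ \oo _ _ (filterI h1 h2).
  by have := lt_trans kl kg; rewrite ltxx.
apply/cvg_ex; exists (inf B); apply/cvgrPdist_lt => e e0.
have [b Db bL] := inf_adherent e0 hB.
have Le : inf B - e < inf B by rewrite ltrBlDr ltrDl.
(* The rationals satisfy [inf B - e < p < q < inf B]. As [q] is not in [B], the gap hypothesis keeps
   [x] out of the set for [- f] and [- p], and the averages are eventually above [inf B - e]. *)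
have [q] := rat_in_itvoo Le; rewrite in_itv/= => /andP[eq qL].
have [p] := rat_in_itvoo eq; rewrite in_itv/= => /andP[ep pq].
have Dq : excess T f (ratr q) x.
  apply: contrapT => nq; have := ge_inf hB.2 nq.
  by rewrite leNgt qL.
have Dp : ~ excess T (fun y => - f y) (- ratr p) x.
  by move=> Dp; apply: (Dpq p q) => //; rewrite -(ltr_rat R).
have h1 := near_ergodic_average_lt Db bL.
have h2 := near_lt_ergodic_average Dp ep.
near=> k; rewrite ltr_distlC; apply/andP; split; near: k => //.
Unshelve. all: by end_near. Qed.

(** * Integration along a measure-preserving map *)

Section measure_preserving_lemmas.
Context (R : realType) (d : measure_display) (X : measurableType d).
Variables (mu : {measure set X -> \bar R}) (T : X -> X).
Hypothesis T_mp : measure_preserving mu T.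

Let mT : measurable_fun [set: X] T. Proof. exact: T_mp.1. Qed.
Let T_mixin := isMeasurableFun.Build _ _ _ _ _ mT.
Let T_pack : {mfun X >-> X} := HB.pack T T_mixin.

(** Change of variables: the domain [E] is its own preimage, and the pushforward of [mu] agrees with
    [mu] on measurable sets. *)
Lemma ge0_integral_measure_preserving (E : set X) (h : X -> \bar R) :
  measurable E -> T @^-1` E = E -> measurable_fun [set: X] h ->
  (forall x, 0 <= h x)%E ->
  (\int[mu]_(x in E) h (T x) = \int[mu]_(x in E) h x)%E.
Proof.
move=> mE TE mh h0.
have := @ge0_integral_pushforward _ _ _ _ _ _ mT mu E h mE
  (measurable_funTS mh) (fun x _ => h0 x).
rewrite TE => <-.
apply: (@eq_measure_integral _ _ _ _ mu (pushforward mu T_pack)) => A mA _.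
exact: T_mp.2.
Qed.

Lemma integrable_measure_preserving (h : X -> R) :
  mu.-integrable [set: X] (EFin \o h) ->
  mu.-integrable [set: X] (EFin \o (h \o T)).
Proof.
move=> /integrableP[mh hoo]; apply/integrableP; split.
  exact: (measurableT_comp mh mT).
by rewrite (@ge0_integral_measure_preserving setT (fun x => `|(h x)%:E|%E))//;
  exact: measurableT_comp.
Qed.

Lemma measurable_iter n : measurable_fun [set: X] (iter n T).
Proof.
elim: n => [|n IHn]; first exact: measurable_id.
exact: (measurableT_comp mT IHn).
Qed.

Lemma measurable_birkhoff_sum (g : X -> R) k :
  measurable_fun [set: X] g -> measurable_fun [set: X] (birkhoff_sum T g k).
Proof.
move=> mg; apply: measurable_sum => j.
exact: (measurableT_comp mg (measurable_iter j)).
Qed.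

(** Natural thresholds suffice, which leaves countable operations only. *)
Lemma measurable_unbounded_sums (g : X -> R) :
  measurable_fun [set: X] g -> measurable (unbounded_sums T g).
Proof.
move=> mg.
have -> : unbounded_sums T g =
    \bigcap_m \bigcup_k [set x | m%:R < birkhoff_sum T g k x].
  apply/seteqP; split => x /=.
    by move=> Dx m _; have [k] := Dx m%:R; exists k.
  move=> Dx M; have [k _ /= Mk] := Dx (Num.truncn M).+1 I.
  by exists k; exact: lt_trans (truncnS_gt _) Mk.
apply: bigcapT_measurable => m; apply: bigcupT_measurable => k.
rewrite -[X in measurable X]setTI.
exact: (measurable_fun_ltr (measurable_cst (m%:R : R))
  (measurable_birkhoff_sum k mg) measurableT (I : measurable [set true])).
Qed.

(** By induction, since [max(0, u)] is dominated by [|u|]. *)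
Lemma integrable_max_sum (g : X -> R) n :
  mu.-integrable [set: X] (EFin \o g) ->
  mu.-integrable [set: X] (EFin \o max_sum T g n).
Proof.
move=> ig; elim: n => [|n IHn]; first exact: integrable0.
have iD := integrableD measurableT ig (integrable_measure_preserving IHn).
apply: le_integrable (iD) => //.
  apply/measurable_EFinP; apply: measurable_maxr => //.
  by apply/measurable_EFinP; case/integrableP: iD.
move=> x _ /=; rewrite lee_fin.
by have [_|_] := leP 0 (g x + max_sum T g n (T x)); rewrite ?normr0.
Qed.

Lemma integral_unbounded_sums_ge0 (g : X -> R) (E : set X) :
  mu.-integrable [set: X] (EFin \o g) ->
  measurable E -> T @^-1` E = E -> E `<=` unbounded_sums T g ->
  0 <= \int[mu]_(x in E) g x.
Proof.
move=> ig mE TE ED; apply: fine_ge0.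
pose h n x := max_sum T g n.+1 x - max_sum T g n (T x).
have iM n : mu.-integrable E (EFin \o max_sum T g n).
  by apply: integrableS (integrable_max_sum n ig).
have iMT n : mu.-integrable E (EFin \o (max_sum T g n \o T)).
  have iT := integrable_measure_preserving (integrable_max_sum n ig).
  by apply: integrableS iT.
have ih n : mu.-integrable E (EFin \o h n).
  by have := integrableB mE (iM n.+1) (iMT n).
(* Over the invariant [E], composing [max_sum T g n] with [T] does not change its integral, and
   [max_sum] increases with [n]. *)
have int_h n : (0 <= \int[mu]_(x in E) (h n x)%:E)%E.
  have -> : (\int[mu]_(x in E) (h n x)%:E = \int[mu]_(x in E)
      (max_sum T g n.+1 x)%:E - \int[mu]_(x in E) (max_sum T g n x)%:E)%E.
    rewrite -(@ge0_integral_measure_preserving E (EFin \o max_sum T g n))//.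
    - by rewrite -(integralB mE (iM n.+1) (iMT n)).
    - by case/integrableP: (integrable_max_sum n ig).
    - by move=> x; rewrite lee_fin max_sum_ge0.
  rewrite sube_ge0; last by rewrite (integrable_fin_num mE (iM n)).
  apply: (le_integral mE (iM n) (iM n.+1)) => x _.
  by rewrite lee_fin max_sum_leS.
have igE : mu.-integrable E (EFin \o g) by apply: integrableS ig.
have [] := @dominated_convergence _ _ _ mu E mE (fun n => EFin \o h n)
  (EFin \o g) (fun x => `|(g x)%:E|%E).
- by move=> n; case/integrableP: (ih n).
- by case/integrableP: igE.
- apply: aeW => x Ex.
  have ETx : E (T x) by rewrite -TE in Ex.
  (* Some sum at [T x] exceeds [- g x]; from that length on, the outer maximum is its second
     argument and [h n x] equals [g x] exactly. *)
  have [k gk] := ED _ ETx (- g x).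
  apply: cvg_near_cst; exists k => // n /= kn; congr EFin.
  have : 0 < g x + max_sum T g n (T x).
    by rewrite -ltrBlDl sub0r (lt_le_trans gk)// birkhoff_sum_le_max_sum.
  by rewrite /h /= => /ltW/max_r ->; rewrite addrK.
- exact: integrable_abse.
- apply: aeW => x n Ex; rewrite lee_fin /h /=.
  have := max_sum_ge0 T g n (T x).
  set m := max_sum T g n (T x) => m0.
  (* Either [h n x = g x], or [h n x = - m] with [0 <= m < - g x]. *)
  have [gm|gm] := leP 0 (g x + m).
    by rewrite addrK.
  rewrite sub0r normrN ger0_norm//.
  rewrite -(normrN (g x)) (le_trans _ (ler_norm _))//.
  by rewrite lerNr; apply: ltW; rewrite -ltrBrDr sub0r in gm.
by move=> _ _; apply: cvge_ge; exact: nearW.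
Qed.

End measure_preserving_lemmas.

(** * Integral bounds and null sets *)

Section maximal_ergodic_inequality.
Context (R : realType) (d : measure_display) (X : measurableType d).
Variables (mu : {finite_measure set X -> \bar R}) (T : X -> X) (f : X -> R).
Hypothesis T_mp : measure_preserving mu T.
Hypothesis f_L1 : mu.-integrable [set: X] (EFin \o f).

Lemma measurable_excess b : measurable (excess T f b).
Proof.
apply: (measurable_unbounded_sums T_mp).
by apply: measurable_funB => //; apply/measurable_EFinP; case/integrableP: f_L1.
Qed.

(** Integral positivity for [f - b]; the constant [b] is integrable because [mu] is finite. *)
Lemma le_integral_excess (E : set X) (b : R) :
  measurable E -> T @^-1` E = E -> E `<=` excess T f b ->
  b * fine (mu E) <= \int[mu]_(x in E) f x.
Proof.
move=> mE TE Eb.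
have ib : mu.-integrable setT (EFin \o cst b).
  exact: finite_measure_integrable_cst.
rewrite -(Rintegral_cst mu mE) -subr_ge0 -RintegralB//.
- apply: (integral_unbounded_sums_ge0 T_mp) => //.
  exact: (integrableB measurableT f_L1 ib).
- exact: integrableS f_L1.
- exact: integrableS ib.
Qed.

(** On the intersection [E], [n * mu E] stays below the fixed integral of [f] for all [n], which
    forces [mu E = 0]. *)
Lemma negligible_bigcap_excess :
  mu.-negligible (\bigcap_n excess T f n%:R).
Proof.
set E := \bigcap_n _.
have mE : measurable E.
  by apply: bigcapT_measurable => n; exact: measurable_excess.
exists E; split => //.
have TE : T @^-1` E = E.
  rewrite /E preimage_bigcap; apply: eq_bigcapr => n _.
  exact: unbounded_sums_invariant.
have muE n : n%:R * fine (mu E) <= \int[mu]_(x in E) f x.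
  by apply: le_integral_excess => // x; apply.
rewrite -[LHS]fineK ?fin_num_measure//; congr EFin.
apply/eqP; rewrite eq_le fine_ge0// andbT leNgt; apply/negP => E0.
have := muE (Num.truncn ((\int[mu]_(x in E) f x) / fine (mu E))).+1.
by rewrite -ler_pdivlMr// leNgt truncnS_gt.
Qed.

End maximal_ergodic_inequality.

Lemma integrable_oppr (R : realType) (d : measure_display)
    (X : measurableType d) (mu : {measure set X -> \bar R}) (f : X -> R) :
  mu.-integrable [set: X] (EFin \o f) ->
  mu.-integrable [set: X] (EFin \o (fun x => - f x)).
Proof. exact: integrableN. Qed.

(** Applied to [f] and to [- f], the integral bound gives [b * mu E <= a * mu E] on the intersection
    [E]. *)
Lemma negligible_excess_gap (R : realType) (d : measure_display)
    (X : measurableType d) (mu : {finite_measure set X -> \bar R}) (T : X -> X)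
    (f : X -> R) (a b : R) :
  measure_preserving mu T -> mu.-integrable [set: X] (EFin \o f) -> a < b ->
  mu.-negligible (excess T f b `&` excess T (fun y => - f y) (- a)).
Proof.
move=> T_mp f_L1 ab; have Nf_L1 := integrable_oppr f_L1.
set E := _ `&` _.
have mE : measurable E by apply: measurableI; exact: (measurable_excess T_mp).
exists E; split => //.
have TE : T @^-1` E = E by rewrite preimage_setI !unbounded_sums_invariant.
have h1 := le_integral_excess T_mp f_L1 mE TE (@subIsetl _ _ _).
have h2 := le_integral_excess T_mp Nf_L1 mE TE (@subIsetr _ _ _).
have fE : mu.-integrable E (EFin \o f) by exact: integrableS f_L1.
have intN : \int[mu]_(x in E) - f x = - \int[mu]_(x in E) f x.
  rewrite -mulN1r -RintegralZl//.
  by apply: eq_Rintegral => x _; rewrite mulN1r.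
rewrite intN in h2.
rewrite -[LHS]fineK ?fin_num_measure//; congr EFin.
apply/eqP; rewrite eq_le fine_ge0// andbT leNgt; apply/negP => E0.
have : a * fine (mu E) < b * fine (mu E) by rewrite ltr_pM2r.
by rewrite ltNge -[X in _ <= X]opprK (le_trans h1)// lerNr -mulNr.
Qed.

(** Reindexing by codes gives a sequence of sets; codes of no element contribute [set0]. *)
Lemma negligible_bigcup_countType (R : realType) (d : measure_display)
    (X : measurableType d) (mu : {measure set X -> \bar R}) (I : countType)
    (F : I -> set X) :
  (forall i, mu.-negligible (F i)) -> mu.-negligible (\bigcup_i F i).
Proof.
move=> F0.
have : mu.-negligible (\bigcup_n oapp F set0 (@unpickle I n)).
  apply: negligible_bigcup => n; case: unpickle => [i|] //=.
  exact: negligible_set0.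
by apply: negligibleS => x [i _ Fix]; exists (pickle i); rewrite ?pickleK.
Qed.

Theorem mainTheorem2 (R : realType) (d : measure_display)
    (X : measurableType d) (mu : probability X R) (T : X -> X)
    (T_mp : measure_preserving mu T) (f : X -> R)
    (f_L1 : mu.-integrable [set: X] (EFin \o f)) :
  {ae mu, forall x : X, cvg (ergodic_average T f k x @[k --> \oo])}.
Proof.
have Nf_L1 := integrable_oppr f_L1.
have h1 := negligible_bigcap_excess T_mp f_L1.
have h2 := negligible_bigcap_excess T_mp Nf_L1.
pose F (r : rat * rat) := if r.1 < r.2 then
  excess T f (ratr r.2) `&` excess T (fun y => - f y) (- ratr r.1) else set0.
have h3 : mu.-negligible (\bigcup_r F r).
  apply: negligible_bigcup_countType => -[p q]; rewrite /F /=.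
  case: ifP => [pq|_]; last exact: negligible_set0.
  by apply: negligible_excess_gap; rewrite ?ltr_rat.
(* A point of divergence outside all three null sets would satisfy the pointwise criterion. *)
apply: negligibleS (negligibleU (negligibleU h1 h2) h3) => x /= ncvg.
apply: contrapT => /not_orP[/not_orP[/existsNP[m /not_implyP[_ xm]]
  /existsNP[n /not_implyP[_ xn]]] xF].
apply: ncvg; apply: cvg_ergodic_average; [by exists m%:R|by exists n%:R|].
by move=> p q pq Dpq; apply: xF; exists (p, q); rewrite // /F pq.
Qed.
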